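(* Let $-\infty < \beta < 0$. There is no real-valued random variable $X$ such that, for a sequence $X_1, X_2, \ldots$ of independent copies of $X$ with partial sums $S_n = X_1 + \cdots + X_n$, $n \ge 1$, one has $$\limsup_{n \rightarrow \infty} \left| \frac{S_{n}}{\sqrt{n}} \right|^{(\log \log n)^{-1}} = e^{\beta} \quad \text{almost surely}.$$
   Context: $\log$ is the natural logarithm; the quantity $|\cdot|^{(\log\log n)^{-1}}$ is considered for $n \ge 3$. *)

(* Defs.v *)
From HB Require Import structures.
From mathcomp Require Export all_boot all_order all_algebra.
From mathcomp Require Export all_classical all_reals all_analysis.

Set Implicit Arguments.
Unset Strict Implicit.
Unset Printing Implicit Defensive.

Import Order.TTheory GRing.Theory Num.Theory.
Import numFieldNormedType.Exports.

Local Open Scope classical_set_scope.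
Local Open Scope ring_scope.

(* [uniq J] makes [J] an enumeration of a finite set of indices; the equation
   holds trivially for [J = [::]]. *)
Definition mutually_independent (R : realType) (d : measure_display)
    (T : measurableType d) (P : probability T R) (X : nat -> {RV P >-> R}) :
    Prop :=
  forall (J : seq nat) (B : nat -> set R),
    uniq J -> (forall j, measurable (B j)) ->
    P (\bigcap_(j in [set` J]) (X j @^-1` B j)) =
    (\prod_(j <- J) P (X j @^-1` B j))%E.

(* The copies may live on another probability space than [X]. *)
Definition independent_copies (R : realType)
    (d : measure_display) (T : measurableType d) (P : probability T R)
    (X : {RV P >-> R})
    (d' : measure_display) (T' : measurableType d') (P' : probability T' R)
    (Xs : nat -> {RV P' >-> R}) : Prop :=
  mutually_independent Xs /\
  forall (n : nat) (B : set R), measurable B ->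
    distribution P' (Xs n) B = distribution P X B.

(* The copies are indexed from 0: [Xs i] is the mathematical X_(i+1), so that
   [partial_sum Xs n] is S_n = X_1 + ... + X_n. *)
Definition partial_sum (R : realType) (d : measure_display)
    (T : measurableType d) (P : probability T R) (Xs : nat -> {RV P >-> R})
    (n : nat) (t : T) : R :=
  \sum_(i < n) Xs i t.

(* The exponent 1 / log log n is positive for n >= 3, where [a `^ x] is the
   usual power, with [0 `^ x = 0]. The (finite) values at n < 3 rely on the
   total conventions for [ln] and inverse, and do not affect a limsup. *)
Definition loglog_norm (R : realType) (d : measure_display)
    (T : measurableType d) (P : probability T R) (Xs : nat -> {RV P >-> R})
    (n : nat) (t : T) : R :=
  `| partial_sum Xs n t / Num.sqrt n%:R | `^ (ln (ln n%:R))^-1.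

(* Main.v *)
From HB Require Import structures.
Require Import Defs.
From mathcomp Require Import ring lra measurable_realfun.

Set Implicit Arguments.
Unset Strict Implicit.
Unset Printing Implicit Defensive.

Import Order.TTheory GRing.Theory Num.Theory.
Import numFieldNormedType.Exports.

Local Open Scope classical_set_scope.
Local Open Scope ring_scope.

(** The condition on the limsup with beta < 0 forces S_n / sqrt n to tend to 0
    almost surely: eventually |S_n / sqrt n| is at most
    exp (beta / 2 * log log n) ([limsup_loglog_cvg0]). Only the zero variable
    has this property, and for it the limsup is 0, not e ^ beta.

    To see that X must vanish, let phi be the characteristic function of X,
    and rho (s) = |phi (s)| ^ 2, which is also the real characteristic
    function of X_1 - X_2. Independence gives
    |E exp (i s S_n)| ^ 2 = rho (s) ^ n ([chf_normsq_psum]), so by dominated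
    convergence, along the squares n = m ^ 2, rho (s / m) ^ (m ^ 2) tends
    to 1. The inequality 1 - cos (m x) <= m ^ 2 (1 - cos x) integrates to
    1 - rho (s) <= m ^ 2 (1 - rho (s / m)) ([chf_re_scale]); if rho (s) were
    smaller than 1, this would keep rho (s / m) ^ (m ^ 2) away from 1
    ([bernoulli_decay]). Hence rho = 1 everywhere ([chf_normsq_eq1]), so that
    X_1 - X_j = 0 almost surely for each j ([chf_re_eq1_ae],
    [ae_all_equal]). Then S_n / sqrt n = sqrt n X_1, whose convergence to 0
    forces X_1 = 0.

    The characteristic function of U is represented by the pair of
    E cos (s U) and E sin (s U). *)

(** * Independence of a partial sum from the later variables *)

Section independence.
Context (R : realType) (d : measure_display) (T : measurableType d).
Variable P : probability T R.
Local Open Scope ereal_scope.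

Definition independent (U V : {mfun T >-> R}) : Prop :=
  forall A B, measurable A -> measurable B ->
    P (U @^-1` A `&` V @^-1` B) = P (U @^-1` A) * P (V @^-1` B).

Definition joint (U V : T -> R) (t : T) : R * R := (U t, V t).

Lemma measurable_joint (U V : {mfun T >-> R}) :
  measurable_fun [set: T] (joint U V).
Proof. exact: measurable_fun_pair. Qed.

HB.instance Definition _ (U V : {mfun T >-> R}) :=
  isMeasurableFun.Build _ _ _ _ (joint U V) (measurable_joint U V).

(** The joint law is determined by its values on rectangles, where
    independence gives the product of the marginal laws. *)
Lemma joint_law (U V : {mfun T >-> R}) (C : set (R * R)) :
  independent U V -> measurable C ->
  distribution P (joint U V) C = (distribution P U \x distribution P V) C.
Proof.
move=> UV mC; apply/esym; apply: (product_measure_unique _ mC) => A B mA mB.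
exact: UV.
Qed.

(** Independence from an event [D], known for rectangles, extends to all events
    in the plane: up to the factor [P D], the law of the pair restricted to [D]
    and the unrestricted one are two measures agreeing on rectangles. *)
Lemma independent_joint_event (U V : {mfun T >-> R}) (D : set T) :
  measurable D -> independent U V ->
  (forall A B, measurable A -> measurable B ->
    P (U @^-1` A `&` V @^-1` B `&` D) =
    P (U @^-1` A) * P (V @^-1` B) * P D) ->
  forall C, measurable C ->
    P (joint U V @^-1` C `&` D) = P (joint U V @^-1` C) * P D.
Proof.
move=> mD UV UVD C mC.
have PDE : (fine (P D))%:E = P D by rewrite fineK// fin_num_measure.
pose p := NngNum (fine_ge0 (measure_ge0 P D)).
(* Both sides equal the product measure whose second factor is scaled by P D. *)
transitivity ((distribution P U \x mscale p (distribution P V)) C).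
  apply/esym.
  apply: (@product_measure_unique _ _ _ _ R (distribution P U)
    (mscale p (distribution P V))
    (pushforward (mrestr P mD) (joint U V)) _ _ mC).
  move=> A B mA mB; rewrite /= /pushforward /mrestr /mscale/= PDE.
  by rewrite muleCA [RHS]muleC; exact: UVD.
rewrite muleC -PDE.
apply: (@product_measure_unique _ _ _ _ R (distribution P U)
    (mscale p (distribution P V))
    (mscale p (distribution P (joint U V))) _ _ mC).
move=> A B mA mB; rewrite /mscale/= muleCA; congr (_ * _).
exact: UV.
Qed.

End independence.

Section partial_sums.
Context (R : realType) (d : measure_display) (T : measurableType d).
Variables (P : probability T R) (Xs : nat -> {RV P >-> R}).
Hypothesis indXs : mutually_independent Xs.
Local Open Scope ereal_scope.

(** [partial_sum] as an element of the ring of measurable functions, so that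
    its measurability is carried by its type. *)
Definition psum (n : nat) : {mfun T >-> R} :=
  (\sum_(i < n) (Xs i : {mfun T >-> R}))%R.

Lemma psumE n t : psum n t = partial_sum Xs n t.
Proof. by rewrite /psum mfun_sum. Qed.

Lemma psumS n : psum n.+1 = (psum n + (Xs n : {mfun T >-> R}))%R.
Proof. by rewrite /psum big_ord_recr. Qed.

(** Mutual independence speaks of the variables one by one; it passes to sums by
    induction on [n]. The event that [psum n.+1] lies in [A] concerns the pair
    ([psum n], [Xs n]), and the induction hypothesis, applied to the index list
    [n :: J], says that this pair is independent of the later variables on
    rectangles. *)
Lemma psum_independent_later n (A : set R) (J : seq nat) (B : nat -> set R) :
  measurable A -> (forall j, measurable (B j)) ->
  uniq J -> all (leq n) J ->
  P (psum n @^-1` A `&` \bigcap_(j in [set` J]) (Xs j @^-1` B j)) =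
  P (psum n @^-1` A) * \prod_(j <- J) P (Xs j @^-1` B j).
Proof.
elim: n A J B => [|n IH] A J B mA mB uJ nJ.
  rewrite -(indXs uJ mB); have [A0|A0] := pselect (A 0%R).
    rewrite (_ : psum 0 @^-1` A = setT) ?setTI ?probability_setT ?mul1e//.
    apply/seteqP; split => // t _.
    by rewrite /preimage/= psumE /partial_sum big_ord0.
  rewrite (_ : psum 0 @^-1` A = set0) ?set0I ?measure0 ?mul0e//.
  apply/seteqP; split => // t.
  by rewrite /preimage/= psumE /partial_sum big_ord0.
have nJ' : n \notin J.
  by apply/negP => /(allP nJ); rewrite ltnn.
have nJle : all (leq n) J by apply/allP => j /(allP nJ) /ltnW.
have indn : independent P (psum n) (Xs n).
  move=> A1 A2 mA1 mA2.
  have := IH A1 [:: n] (fun=> A2) mA1 (fun=> mA2) isT.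
  by rewrite /= leqnn big_seq1 set_cons1 bigcap_set1; exact.
set D := \bigcap_(j in [set` J]) _.
have mD : measurable D.
  by apply: fin_bigcap_measurable => // j _; exact: measurable_funPTI.
have PD : P D = \prod_(j <- J) P (Xs j @^-1` B j) by exact: indXs.
rewrite -PD.
pose C := (fun z : R * R => z.1 + z.2)%R @^-1` A.
have mC : measurable C.
  have m : measurable_fun [set: R * R] (fun z : R * R => z.1 + z.2)%R.
    by apply: measurable_funD.
  by rewrite -[C]setTI; exact: m.
have -> : psum n.+1 @^-1` A = joint (psum n) (Xs n) @^-1` C by rewrite psumS.
apply: independent_joint_event => // A1 A2 mA1 mA2.
(* The event {Xs n in A2} joins the list J as its entry n. *)
pose B' j := if j == n then A2 else B j.
have B'E j : j \in J -> B' j = B j.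
  by rewrite /B'; case: eqP nJ' => // -> /negP.
have mB' j : measurable (B' j) by rewrite /B'; case: ifP.
have DE : D = \bigcap_(j in [set` J]) (Xs j @^-1` B' j).
  by apply: eq_bigcapr => j /= /B'E ->.
have PDE : P D = \prod_(j <- J) P (Xs j @^-1` B' j).
  by rewrite PD; apply: eq_big_seq => j /B'E ->.
have nJE : [set` n :: J] = n |` [set` J].
  apply/seteqP; split => j /=; rewrite inE.
    by case/predU1P => [->|]; [left|right].
  by case=> [->|->]; rewrite ?eqxx ?orbT.
have := IH A1 (n :: J) B' mA1 mB'.
rewrite /= nJ' leqnn uJ nJle => /(_ isT isT).
rewrite nJE bigcap_setU1 big_cons -DE -PDE setIA muleA.
by rewrite (_ : B' n = A2) // /B' eqxx.
Qed.

End partial_sums.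

(** * Characteristic functions *)

Section trigonometry.
Context (R : realType).
Implicit Types x : R.

Lemma onem_cosE x : 1 - cos (x *+ 2) = sin x ^+ 2 *+ 2.
Proof. by rewrite cos_mulr2n sin2cos2; ring. Qed.

(** Induction on [n] with the addition formula, as |cos| <= 1. *)
Lemma normr_sin_scale n x : `|sin (n%:R * x)| <= n%:R * `|sin x|.
Proof.
elim: n => [|n IH]; first by rewrite !mul0r sin0 normr0.
rewrite -natr1 !mulrDl !mul1r sinD (le_trans (ler_normD _ _))// !normrM lerD//.
  by apply: le_trans IH; rewrite ler_piMr// cos_max.
by rewrite ler_piMl// cos_max.
Qed.

(** By 1 - cos (2 y) = 2 sin ^ 2 y this is the square of [normr_sin_scale]. *)
Lemma onem_cos_scale n x : 1 - cos (n%:R * x) <= n%:R ^+ 2 * (1 - cos x).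
Proof.
rewrite (_ : x = (x / 2) *+ 2); last by rewrite -mulr_natr divfK.
rewrite mulrnAr !onem_cosE mulrnAr ler_wMn2r//.
rewrite -(real_normK (num_real (sin (x / 2)))).
rewrite -(real_normK (num_real (sin (_ * _)))) -exprMn.
by rewrite ler_sqr ?nnegrE ?mulr_ge0// normr_sin_scale.
Qed.

End trigonometry.

Section bounded_expectation.
Context (R : realType) (d : measure_display) (T : measurableType d).
Variable P : {finite_measure set T -> \bar R}.

Lemma bounded_integrable (f : T -> R) (M : R) :
  measurable_fun [set: T] f -> (forall t, `|f t| <= M) ->
  P.-integrable [set: T] (EFin \o f).
Proof.
move=> mf fM; apply: measurable_bounded_integrable => //.
  by rewrite -ge0_fin_numE// fin_num_measure.
exists M; split; first exact: num_real.
by move=> y My t _; exact: le_trans (fM t) (ltW My).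
Qed.

End bounded_expectation.

Section characteristic_function.
Context (R : realType) (d : measure_display) (T : measurableType d).
Variable P : probability T R.
Implicit Types (U V : {mfun T >-> R}) (f g : R -> R).

Lemma expectation_of_law U f : measurable_fun [set: R] f ->
  (forall x, `|f x| <= 1) ->
  \int[P]_t f (U t) = \int[distribution P U]_x f x.
Proof.
move=> mf f1; rewrite /Rintegral; congr fine; apply/esym.
have mfU : measurable_fun [set: T] (f \o U) by exact: measurableT_comp.
apply: (@integral_distribution _ _ _ _ _ P U (EFin \o f)).
  exact/measurable_EFinP.
exact: (bounded_integrable _ mfU (fun t => f1 (U t))).
Qed.

(** Fubini's theorem for the joint law, which is a product measure. *)
Lemma expectation_independent U V f g : independent P U V ->
  measurable_fun [set: R] f -> measurable_fun [set: R] g ->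
  (forall x, `|f x| <= 1) -> (forall x, `|g x| <= 1) ->
  \int[P]_t (f (U t) * g (V t)) =
  (\int[P]_t f (U t)) * (\int[P]_t g (V t)).
Proof.
move=> UV mf mg f1 g1.
pose F (z : R * R) : R := f z.1 * g z.2.
have F1 z : `|F z| <= 1 by rewrite normrM mulr_ile1.
have mF : measurable_fun [set: R * R] F.
  by apply: measurable_funM; exact: measurableT_comp.
have mFUV : measurable_fun [set: T] (F \o joint U V).
  by apply: measurableT_comp => //; exact: measurable_joint.
have iFP : P.-integrable [set: T] (EFin \o (F \o joint U V)).
  by apply: (bounded_integrable _ mFUV) => t; exact: F1.
have finUV : ((distribution P U \x distribution P V) [set: R * R] < +oo)%E.
  rewrite -setXTT product_measure1E// ?[X in (X * _)%E]probability_setT.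
  by rewrite mul1e [ltLHS]probability_setT ltry.
have iF : (distribution P U \x distribution P V)%E.-integrable [set: R * R]
    (EFin \o F).
  apply: measurable_bounded_integrable => //.
  exists 1; split; first exact: num_real.
  by move=> y y1 z _; exact: le_trans (F1 z) (ltW y1).
have ig : (distribution P V).-integrable [set: R] (EFin \o g).
  exact: bounded_integrable mg g1.
have if' : (distribution P U).-integrable [set: R] (EFin \o f).
  exact: bounded_integrable mf f1.
rewrite !expectation_of_law//.
transitivity (fine (\int[distribution P U]_x
    fubini_F (distribution P V) (EFin \o F) x)).
  congr fine; rewrite integral12_prod_meas1//.
  transitivity (\int[distribution P (joint U V)]_z (F z)%:E)%E.
    apply/esym.
    apply: (@integral_distribution _ _ _ _ _ P (joint U V) (EFin \o F)) => //.
    exact/measurable_EFinP.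
  apply: eq_measure_integral => C mC _.
  exact: joint_law.
rewrite -RintegralZr//; congr fine.
apply: eq_integral => x _.
rewrite /fubini_F/=; under eq_integral do rewrite /F/= EFinM.
rewrite integralZl// EFinM; congr (_ * _)%E.
by rewrite /Rintegral fineK//; exact: integrable_fin_num.
Qed.

(** Real part, imaginary part and squared modulus of the characteristic
    function E exp (i s U). *)
Definition chf_re (s : R) (U : T -> R) : R := \int[P]_t cos (s * U t).
Definition chf_im (s : R) (U : T -> R) : R := \int[P]_t sin (s * U t).
Definition chf_normsq (s : R) (U : T -> R) : R :=
  chf_re s U ^+ 2 + chf_im s U ^+ 2.

(** A common name for the two functions occurring in the real and imaginary
    parts of exp (i s U), so that integrability and product rules are proved
    once for both. *)
Definition circular (c : R -> R) : Prop := c = cos \/ c = sin.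

Lemma circular_bounded c x : circular c -> `|c x| <= 1.
Proof. by case=> ->; [exact: cos_max|exact: sin_max]. Qed.

Lemma measurable_circular c s : circular c ->
  measurable_fun [set: R] (fun x => c (s * x)).
Proof.
move=> cc; apply: measurableT_comp; last exact: measurable_funM.
apply: continuous_measurable_fun.
by case: cc => ->; [exact: continuous_cos|exact: continuous_sin].
Qed.

Lemma integrable_circular c s U : circular c ->
  P.-integrable [set: T] (EFin \o (fun t => c (s * U t))).
Proof.
move=> cc; apply: (@bounded_integrable _ _ _ _ _ 1) => [|t].
  exact: (measurableT_comp (measurable_circular s cc)).
exact: circular_bounded.
Qed.

Lemma integrable_circularM c1 c2 s U V : circular c1 -> circular c2 ->
  P.-integrable [set: T] (EFin \o (fun t => c1 (s * U t) * c2 (s * V t))).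
Proof.
move=> cc1 cc2; apply: (@bounded_integrable _ _ _ _ _ 1) => [|t].
  apply: measurable_funM.
    exact: (measurableT_comp (measurable_circular s cc1)).
  exact: (measurableT_comp (measurable_circular s cc2)).
by rewrite normrM mulr_ile1// circular_bounded.
Qed.

Lemma expectation_circularM c1 c2 s U V :
  independent P U V -> circular c1 -> circular c2 ->
  \int[P]_t (c1 (s * U t) * c2 (s * V t)) =
  (\int[P]_t c1 (s * U t)) * (\int[P]_t c2 (s * V t)).
Proof.
move=> UV cc1 cc2.
apply: (expectation_independent (f := fun x => c1 (s * x))
  (g := fun x => c2 (s * x)) UV); try exact: measurable_circular.
  by move=> x; exact: circular_bounded.
by move=> x; exact: circular_bounded.
Qed.

Let ccos : circular cos. Proof. by left. Qed.
Let csin : circular sin. Proof. by right. Qed.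

Lemma chf_reD s U V : independent P U V ->
  chf_re s (U + V) = chf_re s U * chf_re s V - chf_im s U * chf_im s V.
Proof.
move=> UV; rewrite /chf_re /chf_im.
under eq_Rintegral do rewrite mfunD/= mulrDr cosD.
by rewrite RintegralB ?expectation_circularM//; exact: integrable_circularM.
Qed.

Lemma chf_imD s U V : independent P U V ->
  chf_im s (U + V) = chf_im s U * chf_re s V + chf_re s U * chf_im s V.
Proof.
move=> UV; rewrite /chf_re /chf_im.
under eq_Rintegral do rewrite mfunD/= mulrDr sinD.
by rewrite RintegralD ?expectation_circularM//; exact: integrable_circularM.
Qed.

(** For [U] and [V] with the same law the right-hand side is
    [chf_normsq s U]. *)
Lemma chf_reB s U V : independent P U V ->
  chf_re s (U - V) = chf_re s U * chf_re s V + chf_im s U * chf_im s V.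
Proof.
move=> UV; rewrite /chf_re /chf_im.
under eq_Rintegral do rewrite mfunB/= mulrBr cosB.
by rewrite RintegralD ?expectation_circularM//; exact: integrable_circularM.
Qed.

(** The squared modulus of a product of complex numbers. *)
Lemma chf_normsqD s U V : independent P U V ->
  chf_normsq s (U + V) = chf_normsq s U * chf_normsq s V.
Proof. by move=> UV; rewrite /chf_normsq chf_reD// chf_imD//; ring. Qed.

Lemma circular_same_law c s U V : circular c ->
  (forall B, measurable B -> distribution P U B = distribution P V B) ->
  \int[P]_t c (s * U t) = \int[P]_t c (s * V t).
Proof.
move=> cc UV; have mc := measurable_circular s cc.
rewrite (expectation_of_law U (f := fun x => c (s * x)))//; last first.
  by move=> x; exact: circular_bounded.
rewrite (expectation_of_law V (f := fun x => c (s * x)))//; last first.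
  by move=> x; exact: circular_bounded.
by congr fine; apply: eq_measure_integral => B mB _; exact: UV.
Qed.

Let expectation_one : \int[P]_t (1 : R) = 1.
Proof.
by rewrite Rintegral_cst// mul1r; exact: (congr1 fine (probability_setT P)).
Qed.

Let integrable_one : P.-integrable [set: T] (EFin \o (fun=> 1 : R)).
Proof. exact: finite_measure_integrable_cst. Qed.

Lemma chf_re_le1 s U : chf_re s U <= 1.
Proof.
rewrite -expectation_one; apply: le_Rintegral => //.
exact: integrable_circular.
Qed.

Lemma integrable_onem_cos s U :
  P.-integrable [set: T] (EFin \o (fun t => 1 - cos (s * U t))).
Proof.
exact: (integrableB measurableT integrable_one (integrable_circular s U ccos)).
Qed.

Lemma expectation_onem_cos s U :
  \int[P]_t (1 - cos (s * U t)) = 1 - chf_re s U.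
Proof.
by rewrite RintegralB ?expectation_one//; exact: integrable_circular.
Qed.

(** A characteristic function cannot be much closer to 1 at [s] than a parabola
    through its value at [n%:R * s] allows. *)
Lemma chf_re_scale s n U :
  1 - chf_re (n%:R * s) U <= n%:R ^+ 2 * (1 - chf_re s U).
Proof.
rewrite -!expectation_onem_cos -RintegralZl//; last first.
  exact: integrable_onem_cos.
apply: le_Rintegral => //.
- exact: integrable_onem_cos.
- exact: (integrableZl measurableT (n%:R ^+ 2) (integrable_onem_cos s U)).
- by move=> t _; rewrite -mulrA; exact: onem_cos_scale.
Qed.

End characteristic_function.

(** * Variables with constant characteristic function *)

Section degenerate.
Context (R : realType) (d : measure_display) (T : measurableType d).
Variable P : probability T R.

(** For [k] large, [x / k.+1] lies in [[- pi, pi]], where cos is 1 only at 0. *)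
Lemma cos_eq1_all (x : R) :
  (forall k : nat, cos (k.+1%:R^-1 * x) = 1) -> x = 0.
Proof.
move=> cx1; have pi1 : 1 <= pi :> R.
  by apply: le_trans (pi_ge2 R); rewrite ler1n.
pose k := Num.truncn `|x|.
have xk : `|x| < k.+1%:R by exact: truncnS_gt.
have k0 : 0 < k.+1%:R :> R by [].
pose y := k.+1%:R^-1 * `|x|.
have y0 : 0 <= y by rewrite mulr_ge0.
have ypi : y <= pi.
  by apply: le_trans pi1; rewrite /y mulrC ler_pdivrMr// mul1r ltW.
have cy : cos y = cos 0.
  rewrite cos0 -(cx1 k) /y; case: (ger0P x) => _ //.
  by rewrite mulrN cosN.
have : y = 0.
  by apply: cos_inj => //; rewrite in_itv/= ?y0 ?ypi ?lexx ?pi_ge0.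
by move=> /eqP; rewrite mulf_eq0 invr_eq0 gt_eqF//= normr_eq0 => /eqP.
Qed.

(** The nonnegative variable 1 - cos (s V) has expectation 0, hence vanishes
    almost surely, for all [s = 1 / k.+1] at once; the exceptional set may
    depend on [s], and countably many [s] suffice by [cos_eq1_all]. *)
Lemma chf_re_eq1_ae (V : {mfun T >-> R}) :
  (forall s, chf_re P s V = 1) -> {ae P, forall t, V t = 0}.
Proof.
move=> V1.
have Vk (k : nat) : {ae P, forall t, cos (k.+1%:R^-1 * V t) = 1}.
  set s : R := k.+1%:R^-1.
  have mf : measurable_fun [set: T] (fun t => 1 - cos (s * V t)).
    apply: measurable_funB => //.
    apply: (measurableT_comp (measurable_circular s _)) => //.
    by left.
  have int0 : (\int[P]_t `|(1 - cos (s * V t))%:E| = 0)%E.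
    have cos1 t : 0 <= 1 - cos (s * V t) by rewrite subr_ge0 cos_le1.
    under eq_integral do rewrite gee0_abs ?lee_fin//.
    have := expectation_onem_cos P s V; rewrite V1 subrr => int0.
    rewrite -[LHS]fineK; last first.
      exact: (integrable_fin_num _ (integrable_onem_cos P s V)).
    by congr EFin.
  have := (ae_eq_integral_abs P measurableT _).1 int0.
  move=> /(_ ((measurable_EFinP _ _).2 mf)).
  apply: filterS => t /(_ I) /= [] /eqP.
  by rewrite subr_eq0 eq_sym => /eqP.
have := ae_foralln Vk.
by apply: filterS => t /cos_eq1_all.
Qed.

(** The left-hand side is nonincreasing in [n]. It bounds [r ^+ n] away from 1
    as soon as [n%:R * (1 - r)] is bounded away from 0. *)
Lemma bernoulli_decay (r : R) n : 0 <= r <= 1 ->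
  r ^+ n * (1 + n%:R * (1 - r)) <= 1.
Proof.
move=> /andP[r0 r1]; elim: n => [|n IH].
  by rewrite expr0 mul0r addr0 mulr1.
apply: le_trans IH; rewrite exprSr -mulrA ler_wpM2l ?exprn_ge0//.
rewrite -natr1; have n0 : 0 <= n%:R :> R by [].
rewrite -subr_ge0 (_ : _ - _ = (n%:R + 1) * (1 - r) ^+ 2); last by ring.
by rewrite mulr_ge0 ?sqr_ge0// addr_ge0.
Qed.

End degenerate.

(** * Independent copies whose normalized sums tend to zero *)

Section iid.
Context (R : realType) (d : measure_display) (T : measurableType d).
Variables (P : probability T R) (Xs : nat -> {RV P >-> R}).
Hypothesis indXs : mutually_independent Xs.
Hypothesis idXs : forall n B, measurable B ->
  distribution P (Xs n) B = distribution P (Xs 0%N) B.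

Lemma psum_independent_next n : independent P (psum Xs n) (Xs n).
Proof.
move=> A B mA mB.
have := psum_independent_later indXs (n := n) (J := [:: n]) mA (fun=> mB) isT.
by rewrite /= leqnn big_seq1 set_cons1 bigcap_set1; exact.
Qed.

Lemma pairwise_independent i j : i != j -> independent P (Xs i) (Xs j).
Proof.
move=> ij A B mA mB.
pose C k := if k == i then A else B.
have mC k : measurable (C k) by rewrite /C; case: ifP.
have := indXs (J := [:: i; j]) (B := C); rewrite /= inE ij => /(_ isT mC).
rewrite big_cons big_seq1 bigcap_seq big_cons big_seq1.
by rewrite /C eqxx eq_sym (negbTE ij).
Qed.

Lemma chf_re_copy s j : chf_re P s (Xs j) = chf_re P s (Xs 0%N).
Proof. by apply: circular_same_law; [left|exact: idXs]. Qed.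

Lemma chf_im_copy s j : chf_im P s (Xs j) = chf_im P s (Xs 0%N).
Proof. by apply: circular_same_law; [right|exact: idXs]. Qed.

Lemma chf_normsq_psum s n :
  chf_normsq P s (psum Xs n) = chf_normsq P s (Xs 0%N) ^+ n.
Proof.
elim: n => [|n IH].
  rewrite /chf_normsq /chf_re /chf_im.
  under eq_Rintegral do rewrite psumE /partial_sum big_ord0 mulr0 cos0.
  under [X in _ + X ^+ 2]eq_Rintegral do
    rewrite psumE /partial_sum big_ord0 mulr0 sin0.
  rewrite !Rintegral_cst// mul0r mul1r.
  have -> : fine (P [set: T]) = 1 by exact: (congr1 fine (probability_setT P)).
  by rewrite expr1n expr0n addr0 expr0.
rewrite psumS chf_normsqD; last exact: psum_independent_next.
by rewrite IH exprSr /chf_normsq chf_re_copy chf_im_copy.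
Qed.

Lemma chf_re_diff s j : j != 0%N ->
  chf_re P s ((Xs 0%N : {mfun T >-> R}) - Xs j) = chf_normsq P s (Xs 0%N).
Proof.
move=> j0; rewrite chf_reB; last by apply: pairwise_independent; rewrite eq_sym.
by rewrite (chf_re_copy s j) (chf_im_copy s j) -!expr2.
Qed.

Hypothesis small : {ae P, forall t,
  psum Xs n t / Num.sqrt n%:R @[n --> \oo] --> 0}.

(** Dominated convergence. The squares [k.+1 ^ 2] make the normalization
    [Num.sqrt] of the index an integer, to which [chf_re_scale] applies. *)
Lemma cvg_chf_re_psum s :
  chf_re P (k.+1%:R^-1 * s) (psum Xs (k.+1 ^ 2)) @[k --> \oo] --> (1 : R).
Proof.
pose f_ k t := (cos (k.+1%:R^-1 * s * psum Xs (k.+1 ^ 2) t))%:E.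
have sq : ((k.+1 ^ 2)%N @[k --> \oo] --> \oo).
  apply/cvgnyPge => A; near=> k.
  have : (A <= k)%N by near: k; exact: nbhs_infty_ge.
  move=> Ak; rewrite -mulnn (leq_trans Ak)//.
  by rewrite (leq_trans (leqnSn k))// leq_pmulr.
have mf_ k : measurable_fun [set: T] (f_ k).
  apply/measurable_EFinP.
  by apply: (measurableT_comp (measurable_circular _ _)) => //; left.
have f_cvg : {ae P, forall t, setT t -> f_ k t @[k --> \oo] --> 1%:E}.
  move: small; apply: filterS => t /= St _.
  have := cvg_comp _ _ sq St.
  move=> {}St; apply: cvg_EFin; first by near=> k.
  set u := (fun k => psum Xs (k.+1 ^ 2) t / Num.sqrt (k.+1 ^ 2)%:R) in St.
  have -> : fine \o f_^~ t = (fun k => cos (s * u k)).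
    apply/funext => k /=; congr cos.
    by rewrite /u natrX sqrtr_sqr ger0_norm//; ring.
  rewrite -[X in _ --> X](_ : cos (s * 0) = 1); last by rewrite mulr0 cos0.
  exact: (cvg_comp _ _ (cvgMl_tmp St) (@continuous_cos R (s * 0))).
have bound : {ae P, forall t k, setT t -> (`|f_ k t| <= (1 : R)%:E)%E}.
  by apply: aeW => t k _; rewrite /f_ lee_fin cos_max.
have [_ _ cvg_int] := dominated_convergence measurableT mf_
  (measurable_cst (1 : R)%:E) f_cvg
  (finite_measure_integrable_cst P (1 : R) measurableT) bound.
have int1 : (\int[P]_t (1 : R)%:E = 1%:E)%E.
  by rewrite integral_cst// mul1e; exact: probability_setT.
rewrite int1 in cvg_int.
exact: (fine_cvg cvg_int).
Unshelve. all: by end_near. Qed.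

(** With rho the squared modulus of the characteristic function of [Xs 0],
    D = 1 - rho (s) and n = k.+1, the scaling inequality gives
    D <= n ^ 2 (1 - rho (s / n)), so that [bernoulli_decay] bounds
    rho (s / n) ^ (n ^ 2) (1 + D) by 1. This power is at least
    [u k ^+ 2], which tends to 1; hence 1 + D <= 1. *)
Lemma chf_normsq_eq1 s : chf_normsq P s (Xs 0%N) = 1.
Proof.
have rho a : 0 <= chf_normsq P a (Xs 0%N) <= 1.
  rewrite {1}/chf_normsq addr_ge0 ?sqr_ge0//=.
  by rewrite -(@chf_re_diff _ 1)// chf_re_le1.
apply/eqP; rewrite eq_le (andP (rho s)).2/=.
set D := 1 - chf_normsq P s (Xs 0%N).
pose u k := chf_re P (k.+1%:R^-1 * s) (psum Xs (k.+1 ^ 2)).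
have u_cvg : u k @[k --> \oo] --> (1 : R) by exact: cvg_chf_re_psum.
have u_le k : u k * u k * (1 + D) <= 1.
  set a := k.+1%:R^-1 * s.
  apply: le_trans (bernoulli_decay (k.+1 ^ 2) (rho a)).
  rewrite -chf_normsq_psum -expr2 ler_pM//.
  - by rewrite sqr_ge0.
  - by rewrite addr_ge0// subr_ge0 (andP (rho s)).2.
  - by rewrite lerDl sqr_ge0.
  rewrite lerD2l natrX /D -!(@chf_re_diff _ 1)//.
  rewrite (_ : s = k.+1%:R * a); last by rewrite /a mulVKf.
  exact: chf_re_scale.
have u2_cvg : u k * u k * (1 + D) @[k --> \oo] --> 1 * 1 * (1 + D).
  exact: cvgMr_tmp (cvgM u_cvg u_cvg).
have : 1 * 1 * (1 + D) <= 1.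
  rewrite -(cvg_lim _ u2_cvg)//; apply: limr_le; last exact: nearW.
  by apply/cvg_ex; eexists; exact: u2_cvg.
by rewrite !mul1r gerDl subr_le0.
Qed.

Lemma ae_all_equal : {ae P, forall t, forall j, Xs j t = Xs 0%N t}.
Proof.
apply: ae_foralln => -[|j]; first exact: aeW.
have : {ae P, forall t, ((Xs 0%N : {mfun T >-> R}) - Xs j.+1) t = 0}.
  by apply: chf_re_eq1_ae => s; rewrite chf_re_diff// chf_normsq_eq1.
apply: filterS => t; rewrite mfunB/= => /eqP.
by rewrite subr_eq0 eq_sym => /eqP.
Qed.

End iid.

(** * From the iterated logarithm to convergence *)

Section loglog.
Context (R : realType).

Lemma lnln_infty (A : R) : \forall n \near \oo, A <= ln (ln n%:R).
Proof.
near=> n.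
have ne : expR (expR A) <= n%:R by near: n; exact: nbhs_infty_ger.
rewrite -[leLHS]expRK ler_ln ?posrE ?expR_gt0//.
  rewrite -[leLHS]expRK ler_ln ?posrE ?expR_gt0//.
  exact: lt_le_trans (expR_gt0 _) ne.
rewrite ln_gt0// (lt_le_trans _ ne)// expR_gt1 expR_gt0//.
Unshelve. all: by end_near. Qed.

(** Eventually [y n] is at most exp (b log log n) with b = beta / 2, an
    exponent strictly between [beta] and 0. *)
Lemma limsup_loglog_cvg0 (y : nat -> R) (beta : R) : beta < 0 ->
  (forall n, 0 <= y n) ->
  limn_esup (fun n => (y n `^ (ln (ln n%:R))^-1)%:E) = (expR beta)%:E ->
  y n @[n --> \oo] --> 0.
Proof.
move=> beta0 y0 ylim.
pose b := beta / 2.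
have b0 : b < 0 by rewrite /b; lra.
have : (limn_esup (fun n => (y n `^ (ln (ln n%:R))^-1)%:E) < (expR b)%:E)%E.
  by rewrite ylim lte_fin ltr_expR /b; lra.
rewrite /limn_esup limf_esupE => /ereal_inf_lt[_ [V V_oo <-] supV].
have yb : \forall n \near \oo, y n `^ (ln (ln n%:R))^-1 <= expR b.
  move: V_oo; apply: filterS => n Vn; rewrite -lee_fin.
  apply: le_trans (ltW supV); apply: ereal_sup_ubound; by exists n.
apply/cvgrPdist_le => e e0; near=> n.
rewrite sub0r normrN ger0_norm//.
have L1 : 1 <= ln (ln (n%:R : R)) by near: n; exact: lnln_infty.
have Le : ln e / b <= ln (ln (n%:R : R)) by near: n; exact: lnln_infty.
have yb_n : y n `^ (ln (ln n%:R))^-1 <= expR b by near: n; exact: yb.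
set L := ln (ln (n%:R : R)) in L1 Le yb_n.
have L0 : 0 < L by exact: lt_le_trans L1.
have -> : y n = (y n `^ L^-1) `^ L.
  by rewrite -powRrM mulVf ?gt_eqF// powRr1.
apply: (@le_trans _ _ (expR b `^ L)).
  apply: ge0_ler_powR; rewrite ?nnegrE ?powR_ge0 ?expR_ge0 ?(ltW L0)//.
rewrite -expRM -[leRHS]lnK ?posrE// ler_expR.
by rewrite mulrC -ler_ndivrMr.
Unshelve. all: by end_near. Qed.

End loglog.

Theorem mainTheorem3 (R : realType) (beta : R) (beta_lt0 : beta < 0) :
  ~ exists (d : measure_display) (T : measurableType d) (P : probability T R)
      (X : {RV P >-> R})
      (d' : measure_display) (T' : measurableType d') (P' : probability T' R)
      (Xs : nat -> {RV P' >-> R}),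
      independent_copies X Xs /\
      {ae P', forall t : T',
        limn_esup (fun n : nat => (loglog_norm Xs n t)%:E) = (expR beta)%:E}.
Proof.
move=> [d [T [P [X [d' [T' [P' [Xs [[indXs lawXs] limsupXs]]]]]]]]].
have idXs n B : measurable B ->
    distribution P' (Xs n) B = distribution P' (Xs 0%N) B.
  by move=> mB; rewrite !lawXs.
have cvg0 t :
    limn_esup (fun n : nat => (loglog_norm Xs n t)%:E) = (expR beta)%:E ->
    partial_sum Xs n t / Num.sqrt n%:R @[n --> \oo] --> 0.
  move=> /(limsup_loglog_cvg0 beta_lt0) => /(_ (fun=> normr_ge0 _)).
  by move=> /norm_cvg0P.
have small : {ae P', forall t, psum Xs n t / Num.sqrt n%:R @[n --> \oo] --> 0}.
  move: limsupXs; apply: filterS => t /cvg0.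
  by under eq_fun do rewrite -psumE.
have all_equal := ae_all_equal indXs idXs small.
(* The contradiction arises at a single point, where both almost sure
   properties hold. *)
have [t [lim_t eq_t]] : exists t,
    limn_esup (fun n : nat => (loglog_norm Xs n t)%:E) = (expR beta)%:E /\
    forall j, Xs j t = Xs 0%N t.
  apply: contrapT => /forallNP none.
  have : {ae P', forall t : T', False}.
    by apply: filterS2 limsupXs all_equal => t ? ?; apply: (none t).
  move=> [N [mN N0 NT]].
  have : P' [set: T'] = 0%E.
    by apply: (subset_measure0 measurableT mN _ N0) => t _; apply: NT => /=.
  by rewrite probability_setT => /eqP; rewrite onee_eq0.
have Sn n : partial_sum Xs n t = n%:R * Xs 0%N t.
  rewrite /partial_sum (eq_bigr (fun=> Xs 0%N t)); last by move=> i _.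
  by rewrite sumr_const card_ord mulr_natl.
(* Here |Xs 0| <= sqrt n |Xs 0| = |S_n / sqrt n| <= e for some n >= 1. *)
have X0 : Xs 0%N t = 0.
  apply/eqP; rewrite -normr_le0; apply/ler_addgt0Pl => e e0; rewrite addr0.
  have /cvgrPdist_le/(_ e e0) := cvg0 t lim_t.
  move=> [N _ /(_ N.+1 (leqnSn N))] /=.
  rewrite sub0r normrN Sn mulrAC normrM; apply: le_trans.
  rewrite ler_peMl// ger0_norm ?divr_ge0//.
  rewrite -{1}(sqr_sqrtr (ler0n R N.+1)) expr2 mulfK ?gt_eqF ?sqrtr_gt0//.
  by rewrite -{1}(sqrtr1 R) ler_wsqrtr// ler1n.
have lim0 : (loglog_norm Xs n t)%:E @[n --> \oo] --> (0 : R)%:E.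
  (* The exponent must be nonzero, as powR 0 0 is 1. *)
  apply: cvg_near_cst.
  have := lnln_infty (1 : R); apply: filterS => n L1.
  rewrite /loglog_norm Sn X0 mulr0 mul0r normr0 powR0//.
  by rewrite invr_eq0 gt_eqF// (lt_le_trans _ L1).
have [_] := cvg_limn_einf_sup lim0; rewrite lim_t => -[] /eqP.
by rewrite gt_eqF ?expR_gt0.
Qed.
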